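(* Let $\mathcal{B}=(\mathcal{O},\mathscr{C},\mathfrak{R},I,T)$ be a synchronously unambiguous bud generating system, with $\mathscr{C}=\{c_1,\dots,c_k\}$, such that $\mathcal{O}$ is a locally finite operad and $\mathfrak{R}(1)$ finitely factorizes $\mathbf{Bud}_{\mathscr{C}}(\mathcal{O})$. For all $a\in\mathscr{C}$, let $\mathbf{f}_a(\mathsf{y}_{c_1},\dots,\mathsf{y}_{c_k})$ be a series of $\mathbb{K}[[\mathbb{Y}_{\mathscr{C}}]]$ satisfying $$\mathbf{f}_a(\mathsf{y}_{c_1},\dots,\mathsf{y}_{c_k})=\mathsf{y}_a+\mathbf{f}_a\bigl(\mathbf{g}_{c_1}(\mathsf{y}_{c_1},\dots,\mathsf{y}_{c_k}),\dots,\mathbf{g}_{c_k}(\mathsf{y}_{c_1},\dots,\mathsf{y}_{c_k})\bigr).$$ Then, for any color $a\in I$ and any type $\alpha\in\mathcal{T}_{\mathscr{C}}$ such that $\mathscr{C}^\alpha\in T^+$, the coefficients $\langle\mathsf{x}_a\mathbb{Y}_{\mathscr{C}}^\alpha,\mathrm{colt}(\mathrm{sync}(\mathcal{B}))\rangle$ and $\langle\mathbb{Y}_{\mathscr{C}}^\alpha,\mathbf{f}_a\rangle$ are equal.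
   Context: Colored operads. Let $\mathscr{C}=\{c_1,\dots,c_k\}$ be a finite set of colors. A $\mathscr{C}$-colored operad $\mathcal{C}=\bigsqcup_{n\geq1}\mathcal{C}(n)$ is a nonsymmetric colored set-operad: each $x\in\mathcal{C}(n)$ has arity $|x|=n$, an output color $\mathrm{out}(x)\in\mathscr{C}$ and a word of input colors $\mathrm{in}(x)\in\mathscr{C}^n$ with $i$-th letter $\mathrm{in}_i(x)$; $x\circ_i y\in\mathcal{C}(|x|+|y|-1)$ is defined iff $\mathrm{out}(y)=\mathrm{in}_i(x)$; there are units $\mathbf{1}_a\in\mathcal{C}(1)$, $a\in\mathscr{C}$, with output and input color $a$; the usual associativity and unit axioms hold. The complete composition is $x\circ[y_1,\dots,y_n]:=(\cdots((x\circ_n y_n)\circ_{n-1}y_{n-1})\cdots)\circ_1 y_1$ (defined when $\mathrm{out}(y_i)=\mathrm{in}_i(x)$ for all $i$). A (monochrome) operad is the case of a single color. $\mathcal{C}$ is locally finite if every $\mathcal{C}(n)$ is finite. Bud operads. For an operad $\mathcal{O}$ with unit $\mathbf{1}$, $\mathbf{Bud}_{\mathscr{C}}(\mathcal{O})$ is the $\mathscr{C}$-colored operad of triples $(a,x,u)\in\mathscr{C}\times\mathcal{O}(n)\times\mathscr{C}^n$, $n\geq1$, with output color $a$, input colors $u$, units $\mathbf{1}_a=(a,\mathbf{1},a)$, and $(a,x,u)\circ_i(b,y,v)=(a,x\circ_i y,u')$ when $b=u_i$, where $u'$ is $u$ with its $i$-th letter replaced by $v$. A bud generating system is a tuple $\mathcal{B}=(\mathcal{O},\mathscr{C},\mathfrak{R},I,T)$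 with $\mathcal{O}$ an operad, $\mathscr{C}$ a finite set of colors, $\mathfrak{R}$ a finite subset of $\mathbf{Bud}_{\mathscr{C}}(\mathcal{O})$ (rules) and $I,T\subseteq\mathscr{C}$. $T^+$ is the set of nonempty words on $T$. Finite factorization. For a subset $S$ of a $\mathscr{C}$-colored operad $\mathcal{C}$, $S(1)$ is the set of its elements of arity $1$, and $\mathbf{Free}(S)$ is the set of planar rooted trees whose internal nodes with $n\geq1$ children are labeled by arity-$n$ elements of $S$, such that if $v$ is the $i$-th child of $u$ (both internal) then the output color of the label of $v$ is the $i$-th input color of the label of $u$; it contains, for each color $a$, a tree consisting of one leaf with output and input color $a$. The evaluation $\mathrm{ev}_{\mathcal{C}}(\mathfrak{t})\in\mathcal{C}$ is obtained by composing in $\mathcal{C}$ the labels along $\mathfrak{t}$ (the one-leaf tree of color $a$ evaluates to $\mathbf{1}_a$). $S$ finitely factorizes $\mathcal{C}$ if for each $x\in\mathcal{C}$ there are finitely many $\mathfrak{t}\in\mathbf{Free}(S)$ with $\mathrm{ev}_{\mathcal{C}}(\mathfrak{t})=x$. Series. $\mathbb{K}$ is a field of characteristic zero. A $\mathcal{C}$-series is a map $\mathbf{f}:\mathcal{C}\to\mathbb{K}$, with values denoted $\langle x,\mathbf{f}\rangle$. The characteristic series of a subset is its indicator function. $\mathbf{u}$ is the characteristic series of $\{\mathbf{1}_a:a\in\mathscr{C}\}$. Composition product: $\langle x,\mathbf{f}\odot\mathbf{g}\rangle:=\sum_{y,z_1,\dots,z_{|y|}\in\mathcal{C},\,x=y\circ[z_1,\dots,z_{|y|}]}\langle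 y,\mathbf{f}\rangle\prod_{i}\langle z_i,\mathbf{g}\rangle$; on a locally finite colored operad it is associative with unit $\mathbf{u}$. $\mathbf{f}^{\odot_\ell}$ is the $\ell$-fold $\odot$-product of $\mathbf{f}$ with itself ($\mathbf{f}^{\odot_0}=\mathbf{u}$), and $\mathbf{f}^{\odot_*}:=\sum_{\ell\geq0}\mathbf{f}^{\odot_\ell}$. Let $\mathbf{r}$, $\mathbf{i}$, $\mathbf{t}$ be the characteristic series of $\mathfrak{R}$, $\{\mathbf{1}_a:a\in I\}$, $\{\mathbf{1}_a:a\in T\}$ in $\mathbf{Bud}_{\mathscr{C}}(\mathcal{O})$. The synchronous generating series is $\mathrm{sync}(\mathcal{B}):=\mathbf{i}\odot\mathbf{r}^{\odot_*}\odot\mathbf{t}$ (well-defined when $\mathcal{O}$ is locally finite and $\mathfrak{R}(1)$ finitely factorizes $\mathbf{Bud}_{\mathscr{C}}(\mathcal{O})$). $\mathcal{B}$ is synchronously unambiguous if all coefficients of $\mathrm{sync}(\mathcal{B})$ are equal to $0$ or $1$. Types. The type of a nonempty word $u$ on $\mathscr{C}$ is $\mathrm{type}(u)=|u|_{c_1}\dots|u|_{c_k}\in\mathbb{N}^k$, where $|u|_c$ is the number of occurrences of $c$ in $u$. $\mathcal{T}_{\mathscr{C}}$ is the set of all types, i.e. of all nonzero elements of $\mathbb{N}^k$. For a type $\alpha$, $\mathscr{C}^\alpha$ is the word $c_1^{\alpha_1}\dots c_k^{\alpha_k}$. $\mathbb{X}_{\mathscr{C}}=\{\mathsf{x}_{c_1},\dots,\mathsf{x}_{c_k}\}$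 and $\mathbb{Y}_{\mathscr{C}}=\{\mathsf{y}_{c_1},\dots,\mathsf{y}_{c_k}\}$ are sets of commuting variables, $\mathbb{Y}_{\mathscr{C}}^\alpha=\mathsf{y}_{c_1}^{\alpha_1}\cdots\mathsf{y}_{c_k}^{\alpha_k}$, and $\langle m,\mathbf{s}\rangle$ is the coefficient of the monomial $m$ in $\mathbf{s}$. The series of color types of a $\mathcal{C}$-series $\mathbf{g}$ is $\mathrm{colt}(\mathbf{g})=\sum_{x\in\mathcal{C}}\langle x,\mathbf{g}\rangle\,\mathsf{x}_{\mathrm{out}(x)}\,\mathbb{Y}_{\mathscr{C}}^{\mathrm{type}(\mathrm{in}(x))}\in\mathbb{K}[[\mathbb{X}_{\mathscr{C}}\sqcup\mathbb{Y}_{\mathscr{C}}]]$. For $a\in\mathscr{C}$, $\mathbf{g}_a(\mathsf{y}_{c_1},\dots,\mathsf{y}_{c_k})$ is the polynomial $\mathbf{g}_a:=\sum_{r\in\mathfrak{R},\,\mathrm{out}(r)=a}\mathbb{Y}_{\mathscr{C}}^{\mathrm{type}(\mathrm{in}(r))}$ (it has no constant term). *)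

(* Defs.v *)
From HB Require Import structures.
From mathcomp Require Import all_boot all_order all_algebra finmap.
From mathcomp Require Import boolp classical_sets functions cardinality fsbigop.
From mathcomp Require Export monalg.

Set Implicit Arguments.
Unset Strict Implicit.
Unset Printing Implicit Defensive.

Import GRing.Theory.
Local Open Scope classical_set_scope.
Local Open Scope ring_scope.

Definition splice (T : Type) (u : seq T) (i : nat) (v : seq T) : seq T :=
  take i u ++ v ++ drop i.+1 u.

(* Nonsymmetric colored set-operads.  The carrier is the disjoint union of all  *)
(* the C(n), the arity of x being the length of its word of input colors.       *)
(* Inputs are numbered from 0.  The partial composition is a total function     *)
(* which is only constrained where it is meant to be defined, that is when the  *)
(* output color of y is the i-th input color of x.                              *)
Record colored_operad (C : finType) := ColoredOperad {
  carrier :> choiceType;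
  out : carrier -> C;
  inp : carrier -> seq C;
  one_of : C -> carrier;
  pcomp : carrier -> nat -> carrier -> carrier;
  inp_gt0 : forall x, (0 < size (inp x))%N;
  out_one : forall a, out (one_of a) = a;
  inp_one : forall a, inp (one_of a) = [:: a];
  out_pcomp : forall x i y, onth (inp x) i = Some (out y) ->
    out (pcomp x i y) = out x;
  inp_pcomp : forall x i y, onth (inp x) i = Some (out y) ->
    inp (pcomp x i y) = splice (inp x) i (inp y);
  pcomp_seq : forall x i y j z,
    onth (inp x) i = Some (out y) -> onth (inp y) j = Some (out z) ->
    pcomp (pcomp x i y) (i + j) z = pcomp x i (pcomp y j z);
  pcomp_par : forall x i y j z, (i < j)%N ->
    onth (inp x) i = Some (out y) -> onth (inp x) j = Some (out z) ->
    pcomp (pcomp x i y) (j + size (inp y)).-1 z = pcomp (pcomp x j z) i y;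
  one_pcomp : forall x, pcomp (one_of (out x)) 0 x = x;
  pcomp_one : forall x i a, onth (inp x) i = Some a -> pcomp x i (one_of a) = x
}.

Notation operad := (colored_operad unit).

Section ColoredOperadTheory.
Variables (C : finType) (P : colored_operad C).

Definition arity (x : P) : nat := size (inp x).

Definition locally_finite : Prop :=
  forall n, finite_set [set x : P | arity x = n].

Definition ccomposable (x : P) (ys : seq P) : Prop := map (@out _ P) ys = inp x.

(* x o [y_1, ..., y_n]: the rightmost input is composed first *)
Definition ccomp (x : P) (ys : seq P) : P :=
  foldr (fun iy z => pcomp z iy.1 iy.2) x (zip (iota 0 (size ys)) ys).

(* Raw planar rooted trees.  The color of a leaf which is not the root is       *)
(* forced by [in_Free] to be the matching input color of its parent, so that    *)
(* recording it adds no information.                                            *)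
Inductive tree := Leaf of C | Node of P & seq tree.

Definition tree_out (t : tree) : C :=
  match t with Leaf a => a | Node x _ => out x end.

Fixpoint in_Free (S : set P) (t : tree) : Prop :=
  match t with
  | Leaf _ => True
  | Node x ts => [/\ S x, map tree_out ts = inp x
                   & foldr (fun t' Q => in_Free S t' /\ Q) True ts]
  end.

Fixpoint ev (t : tree) : P :=
  match t with
  | Leaf a => one_of P a
  | Node x ts => ccomp x (map ev ts)
  end.

Definition finitely_factorizes (S : set P) : Prop :=
  forall x : P, finite_set [set t | in_Free S t /\ ev t = x].

End ColoredOperadTheory.

(* In this section sums indexed by a set are sums over a finite support; they   *)
(* are junk (0) if the support is infinite.  The support of [oprod] is always   *)
(* finite on a locally finite colored operad.                                   *)
Section Series.
Variables (K : fieldType) (C : finType) (P : colored_operad C).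

Definition oseries := P -> K.

Definition char_series (S : set P) : oseries := fun x => (x \in S)%:R.

Definition ones (A : set C) : set P := [set one_of P a | a in A].

Definition oprod (f g : oseries) : oseries := fun x =>
  \sum_(p \in [set p : P * seq P | ccomposable p.1 p.2 /\ x = ccomp p.1 p.2])
    (f p.1 * \prod_(z <- p.2) g z).

Fixpoint oexp (f : oseries) (l : nat) : oseries :=
  if l is l'.+1 then oprod (oexp f l') f else char_series (ones setT).

Definition ostar (f : oseries) : oseries := fun x =>
  \sum_(l \in [set: nat]) oexp f l x.

End Series.

Section Bud.
Variables (C : finType) (O : operad).

Definition bud_pred (p : C * O * seq C) : bool := size p.2 == arity p.1.2.

Definition bud : choiceType := {p : C * O * seq C | bud_pred p}.

Definition bud_out (x : bud) : C := (val x).1.1.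
Definition bud_under (x : bud) : O := (val x).1.2.
Definition bud_inp (x : bud) : seq C := (val x).2.

Lemma bud_one_subproof (a : C) : bud_pred (a, one_of O tt, [:: a]).
Proof. by rewrite /bud_pred /arity /= inp_one. Qed.

Definition bud_one (a : C) : bud := Sub _ (bud_one_subproof a).

(* [insubd] returns its default value x only if i is not an input of x *)
Definition bud_pcomp (x : bud) (i : nat) (y : bud) : bud :=
  insubd x (bud_out x, pcomp (bud_under x) i (bud_under y),
            splice (bud_inp x) i (bud_inp y)).

Lemma bud_ext (x y : bud) : bud_out x = bud_out y ->
  bud_under x = bud_under y -> bud_inp x = bud_inp y -> x = y.
Proof.
move=> e1 e2 e3; apply: val_inj.
rewrite [val x]surjective_pairing [(val x).1]surjective_pairing.
rewrite [val y]surjective_pairing [(val y).1]surjective_pairing.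
by congr (_, _, _).
Qed.

Lemma size_bud_inp (x : bud) : size (bud_inp x) = arity (bud_under x).
Proof. exact/eqP/(valP x). Qed.

Lemma bud_inp_gt0 (x : bud) : (0 < size (bud_inp x))%N.
Proof. by rewrite size_bud_inp; exact: inp_gt0. Qed.

Lemma onth_operad (x y : O) i : (i < arity x)%N ->
  onth (inp x) i = Some (out y).
Proof.
rewrite /arity -onthTE; case: (onth (inp x) i) => [a|//] _.
by case: a; case: (out y).
Qed.

Lemma onth_under (x y : bud) i : onth (bud_inp x) i = Some (bud_out y) ->
  onth (inp (bud_under x)) i = Some (out (bud_under y)).
Proof.
move=> xiy; apply: onth_operad; rewrite -size_bud_inp.
by rewrite -onthTE xiy.
Qed.

Lemma val_bud_pcomp (x : bud) i (y : bud) :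
  onth (bud_inp x) i = Some (bud_out y) ->
  val (bud_pcomp x i y) =
    (bud_out x, pcomp (bud_under x) i (bud_under y),
     splice (bud_inp x) i (bud_inp y)).
Proof.
move=> xiy; rewrite val_insubd ifT // /bud_pred /arity /=.
rewrite inp_pcomp; last exact: onth_under.
by rewrite /splice !size_cat !size_take !size_drop !size_bud_inp.
Qed.

Lemma bud_out_pcomp (x : bud) i (y : bud) :
  onth (bud_inp x) i = Some (bud_out y) ->
  bud_out (bud_pcomp x i y) = bud_out x.
Proof. by move=> xiy; rewrite /bud_out val_bud_pcomp. Qed.

Lemma bud_under_pcomp (x : bud) i (y : bud) :
  onth (bud_inp x) i = Some (bud_out y) ->
  bud_under (bud_pcomp x i y) = pcomp (bud_under x) i (bud_under y).
Proof. by move=> xiy; rewrite {1}/bud_under val_bud_pcomp. Qed.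

Lemma bud_inp_pcomp (x : bud) i (y : bud) :
  onth (bud_inp x) i = Some (bud_out y) ->
  bud_inp (bud_pcomp x i y) = splice (bud_inp x) i (bud_inp y).
Proof. by move=> xiy; rewrite {1}/bud_inp val_bud_pcomp. Qed.

Lemma splice_cat (T : Type) (u1 u2 v : seq T) a :
  splice (u1 ++ a :: u2) (size u1) v = u1 ++ v ++ u2.
Proof. by rewrite /splice take_size_cat // -cat_rcons drop_size_cat ?size_rcons. Qed.

Lemma onth_split (T : Type) (u : seq T) i a : onth u i = Some a ->
  exists u1 u2, u = u1 ++ a :: u2 /\ i = size u1.
Proof.
elim: u i => [|b u IHu] [|i] //=; first by case=> ->; exists [::], u.
by case/IHu => u1 [u2 [-> ->]]; exists (b :: u1), u2.
Qed.

Lemma onth_size_cat (T : Type) (u1 u2 : seq T) a :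
  onth (u1 ++ a :: u2) (size u1) = Some a.
Proof. by rewrite onth_cat ltnn subnn. Qed.

Lemma onth_split2 (T : Type) (u : seq T) i j a b : (i < j)%N ->
  onth u i = Some a -> onth u j = Some b ->
  exists u1 u2 u3, [/\ u = u1 ++ a :: u2 ++ b :: u3, i = size u1
                    & j = size (u1 ++ a :: u2)].
Proof.
move=> ij ua; have [u1 [u2 [-> ei]]] := onth_split ua.
rewrite onth_cat -ei ltnNge (ltnW ij) /= -(subnSK ij) /=.
move=> ub; have [u3 [u4 [-> eq_j]]] := onth_split ub; exists u1, u3, u4; split=> //.
by rewrite size_cat /= -ei -eq_j subnSK // subnKC // ltnW.
Qed.

Lemma bud_pcomp_seq (x : bud) i (y : bud) j (z : bud) :
  onth (bud_inp x) i = Some (bud_out y) ->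
  onth (bud_inp y) j = Some (bud_out z) ->
  bud_pcomp (bud_pcomp x i y) (i + j) z = bud_pcomp x i (bud_pcomp y j z).
Proof.
move=> xiy yjz.
have [u1 [u2 [ux ei]]] := onth_split xiy.
have [v1 [v2 [vy ej]]] := onth_split yjz.
have xiyz : onth (bud_inp x) i = Some (bud_out (bud_pcomp y j z)).
  by rewrite bud_out_pcomp.
have sxy : bud_inp (bud_pcomp x i y) = (u1 ++ v1) ++ bud_out z :: (v2 ++ u2).
  by rewrite bud_inp_pcomp // ux ei splice_cat vy -!catA.
have xyz : onth (bud_inp (bud_pcomp x i y)) (i + j) = Some (bud_out z).
  by rewrite sxy ei ej -size_cat onth_size_cat.
apply: bud_ext.
- by rewrite !bud_out_pcomp.
- by rewrite !bud_under_pcomp // pcomp_seq //; exact: onth_under.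
rewrite bud_inp_pcomp // sxy ei ej -size_cat splice_cat.
by rewrite -ei -ej !bud_inp_pcomp // ux vy ei ej !splice_cat -!catA.
Qed.

Lemma bud_pcomp_par (x : bud) i (y : bud) j (z : bud) : (i < j)%N ->
  onth (bud_inp x) i = Some (bud_out y) ->
  onth (bud_inp x) j = Some (bud_out z) ->
  bud_pcomp (bud_pcomp x i y) (j + size (bud_inp y)).-1 z =
    bud_pcomp (bud_pcomp x j z) i y.
Proof.
move=> ij xiy xjz.
have [u1 [u2 [u3 [ux ei ej]]]] := onth_split2 ij xiy xjz.
have sxy : bud_inp (bud_pcomp x i y) =
    (u1 ++ bud_inp y ++ u2) ++ bud_out z :: u3.
  by rewrite bud_inp_pcomp // ux ei splice_cat -!catA.
have sxz : bud_inp (bud_pcomp x j z) =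
    u1 ++ bud_out y :: (u2 ++ bud_inp z ++ u3).
  by rewrite bud_inp_pcomp // ux ej -cat_cons catA splice_cat -!catA.
have ej' : (j + size (bud_inp y)).-1 = size (u1 ++ bud_inp y ++ u2).
  by rewrite ej !size_cat /= addnS addSn /= -!addnA [(size u2 + _)%N]addnC.
have xyz : onth (bud_inp (bud_pcomp x i y)) (j + size (bud_inp y)).-1 =
    Some (bud_out z) by rewrite sxy ej' onth_size_cat.
have xzy : onth (bud_inp (bud_pcomp x j z)) i = Some (bud_out y).
  by rewrite sxz ei onth_size_cat.
apply: bud_ext.
- by rewrite !bud_out_pcomp.
- rewrite !bud_under_pcomp // size_bud_inp pcomp_par //; exact: onth_under.
rewrite (bud_inp_pcomp xyz) (bud_inp_pcomp xzy) sxy sxz ej' ei !splice_cat.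
by rewrite -!catA.
Qed.

Lemma bud_one_pcomp (x : bud) : bud_pcomp (bud_one (bud_out x)) 0 x = x.
Proof.
have xx : onth (bud_inp (bud_one (bud_out x))) 0 = Some (bud_out x) by [].
apply: bud_ext; rewrite ?bud_out_pcomp ?bud_under_pcomp ?bud_inp_pcomp //.
  rewrite /bud_under /=; move: ((val x).1.2) => y.
  by have -> : tt = out y; [case: (out y) | exact: one_pcomp].
by rewrite /splice /= cats0.
Qed.

Lemma bud_pcomp_one (x : bud) i a :
  onth (bud_inp x) i = Some a -> bud_pcomp x i (bud_one a) = x.
Proof.
move=> xia; have xi1 : onth (bud_inp x) i = Some (bud_out (bud_one a)) by [].
apply: bud_ext; rewrite ?bud_out_pcomp ?bud_under_pcomp ?bud_inp_pcomp //.
  apply: pcomp_one; rewrite (onth_under xi1).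
  by case: (out _).
by have [u1 [u2 [-> ->]]] := onth_split xia; rewrite splice_cat.
Qed.

Definition Bud : colored_operad C :=
  @ColoredOperad C bud bud_out bud_inp bud_one bud_pcomp bud_inp_gt0
    (fun=> erefl) (fun=> erefl) bud_out_pcomp bud_inp_pcomp
    bud_pcomp_seq bud_pcomp_par bud_one_pcomp bud_pcomp_one.

End Bud.

Section PowerSeries.
Variables (K : fieldType).

(* K[[V]]: a series is the map sending each monomial to its coefficient *)
Definition pseries (V : finType) := {cmonom V} -> K.

Definition pvar (V : finType) (v : V) : pseries V := fun m => (m == ucm v)%:R.

(* The product of the variables f a to the powers alpha_a *)
Definition cmon (C V : finType) (f : C -> V) (alpha : {ffun C -> nat}) :
    {cmonom V} := \big[mmul/mone]_(a : C) expcmn (ucm (f a)) (alpha a).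

(* Substitution of a polynomial p v for each variable v of f.  The sum has a    *)
(* finite support when the polynomials p v have no constant term.               *)
Definition psubst (V W : finType) (f : pseries V)
    (p : V -> {malg K[{cmonom W}]}) : pseries W := fun m =>
  \sum_(n \in [set: {cmonom V}]) f n * (\prod_(v : V) p v ^+ n v)@_m.

End PowerSeries.

Section Types.
Variable C : finType.

Definition ctype (u : seq C) : {ffun C -> nat} := [ffun c => count_mem c u].

Definition color_types : set {ffun C -> nat} :=
  [set ctype u | u in [set u | u != [::]]].

(* the colors are ordered by [enum C] *)
Definition type_word (alpha : {ffun C -> nat}) : seq C :=
  flatten [seq nseq (alpha c) c | c <- enum C].

Definition nonempty_words (T : set C) : set (seq C) :=
  [set u | u != [::] /\ {in u, forall c, T c}].

(* The variables x_a and y_a are inl a and inr a *)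
Definition colt (K : fieldType) (P : colored_operad C) (g : oseries K P) :
    pseries K (C + C)%type := fun m =>
  \sum_(x \in [set x : P |
                 mmul (ucm (inl (out x))) (cmon inr (ctype (inp x))) = m]) g x.

End Types.

Record bud_system := BudSystem {
  ground : operad;
  colors : finType;
  rules : set (Bud colors ground);
  rules_finite : finite_set rules;
  initial : set colors;
  terminal : set colors
}.

Arguments rules : clear implicits.
Arguments initial : clear implicits.
Arguments terminal : clear implicits.

Section BudSystem.
Variables (K : fieldType) (B : bud_system).
Local Notation BudB := (Bud (colors B) (ground B)).

Definition unary_rules : set BudB := [set r | rules B r /\ arity r = 1%N].

(* The sum defining [ostar] has a finite support when the ground operad is      *)
(* locally finite and the rules of arity 1 finitely factorize the bud operad.   *)
Definition sync : oseries K BudB :=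
  oprod (oprod (char_series K (ones (initial B)))
               (ostar (char_series K (rules B))))
        (char_series K (ones (terminal B))).

Definition synchronously_unambiguous : Prop :=
  forall x, sync x = 0 \/ sync x = 1.

Definition rule_poly (a : colors B) : {malg K[{cmonom (colors B)}]} :=
  \sum_(r \in [set r | rules B r /\ out r = a]) (<< cmon id (ctype (inp r)) >> : {malg K[_]}).

End BudSystem.

Arguments unary_rules : clear implicits.
Arguments rule_poly : clear implicits.
Arguments sync : clear implicits.

(* Main.v *)
Require Import Defs.
From mathcomp Require Import all_boot all_order all_algebra finmap.
From mathcomp Require Import boolp classical_sets functions cardinality fsbigop.

(** The idea.  Write p_a for the polynomial of the rules with output color a,
    p for the family of the p_a, and r for the characteristic series of the
    rules.

    Multiplying a series by r on the right substitutes the polynomials p in its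
    color types: for each color a, the coefficient of x_a in the series of color
    types of g (.) r is that of g, composed with p ([out_colt_oprod]).  Indeed a
    composition of y with rules z_1, ..., z_n amounts to the choice of a monomial
    in each of the p_c, for c ranging over the word of input colors of y.  Hence
    the coefficient of x_a for the l-th power of r is the l-th iterate of the
    substitution, applied to y_a ([out_colt_oexp]).  On the other hand,
    unfolding f_a = y_a + f_a o p gives f_a as the sum of the same iterates, and
    the coefficients of the two sides of the theorem agree since multiplying by
    the series of the initial and terminal units only selects the colors
    ([syncE]).

    What has to be controlled is the finiteness of the sums over l and the
    remainder of the unfolding.  Both follow from the existence of a positive
    weight on colors for which each rule is strictly expanding, that is, has
    inputs of total weight larger than the weight of its output ([expanding]).
    The weight of the inputs of x then bounds the number of steps which may lead
    to x ([oexp_weight]), and substitution is strictly triangular for the weight away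
    from the constant term, so that its iterates vanish on any given nontrivial
    monomial ([iter_psubst0]).

    Such a weight comes from finite factorization: a cycle of colors linked by
    unary rules would give infinitely many trees, whose evaluations lie in the
    finite set of elements of arity 1 ([no_unary_cycle]).  The unary rules thus
    form an acyclic graph on colors, and the number of ancestors of a color,
    shifted by the number of colors so that two inputs always outweigh one
    output, is suitable ([ancestor_weight_expanding]). *)

Set Implicit Arguments.
Unset Strict Implicit.
Unset Printing Implicit Defensive.

Import GRing.Theory.
Local Open Scope classical_set_scope.
Local Open Scope ring_scope.

(** * Finite sums *)

Section FiniteSums.
Variable V : nmodType.

(** A sum over a possibly infinite set is a sum over any duplicate-free sequence
    containing its support. *)
Lemma fsbig_seq_cond (T : choiceType) (A : set T) (s : seq T) (F : T -> V) :
  uniq s -> (forall x, A x -> x \notin s -> F x = 0) ->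
  \sum_(x \in A) F x = \sum_(x <- s | x \in A) F x.
Proof.
move=> us F0; rewrite (@fsbigE _ _ _ _ A [seq x <- s | x \in A]).
- by rewrite big_filter_cond; apply: eq_bigl => x; rewrite andbb.
- exact: filter_uniq.
- by move=> x /=; rewrite mem_filter => /andP[/set_mem].
move=> x Ax; rewrite mem_filter negb_and (mem_set Ax) /=; exact: F0.
Qed.

Lemma sum_seq_pred1 (T : eqType) (s : seq T) (c : T) (P : pred T) (v : V) :
  uniq s -> (P c -> c \in s) ->
  \sum_(x <- s | P x) v *+ (x == c) = v *+ P c.
Proof.
move=> us cs; case Pc: (P c); last first.
  rewrite big1 // => x Px; case: eqP Px => [->|_]; last by rewrite mulr0n.
  by rewrite Pc.
rewrite big_mkcond (bigD1_seq c) ?cs //= Pc eqxx big1 ?addr0 // => x /negPf->.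
by rewrite mulr0n if_same.
Qed.

End FiniteSums.

(** * Complete compositions *)

Section Composition.
Variables (C : finType) (P : colored_operad C).
Implicit Types (x y : P) (ys : seq P).

(** The tail of a complete composition, in which the inputs of [x] numbered
    from [size u] on are substituted. *)
Lemma ccomp_from x u ys : inp x = u ++ map (@out _ P) ys ->
  let z := foldr (fun iy (z : P) => Defs.pcomp z iy.1 iy.2) x
             (zip (iota (size u) (size ys)) ys) in
  out z = out x /\ inp z = u ++ flatten (map (@inp _ P) ys).
Proof.
elim: ys u => [|y ys IHys] u //= ux.
have /IHys[] : inp x = rcons u (out y) ++ map (@out _ P) ys by rewrite cat_rcons.
rewrite size_rcons; set z := foldr _ _ _ => oz iz.
have zy : onth (inp z) (size u) = Some (out y) by rewrite iz cat_rcons onth_size_cat.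
by rewrite out_pcomp // inp_pcomp // iz cat_rcons splice_cat.
Qed.

Lemma out_ccomp x ys : ccomposable x ys -> out (ccomp x ys) = out x.
Proof. by move=> xys; case: (@ccomp_from x [::] ys (esym xys)). Qed.

Lemma inp_ccomp x ys : ccomposable x ys ->
  inp (ccomp x ys) = flatten (map (@inp _ P) ys).
Proof. by move=> xys; case: (@ccomp_from x [::] ys (esym xys)). Qed.

Lemma map_out_one u : map (@out _ P) (map (@one_of _ P) u) = u.
Proof. by rewrite -map_comp map_id_in // => c _; exact: out_one. Qed.

Lemma ccomp_ones x : ccomp x (map (@one_of _ P) (inp x)) = x.
Proof.
suff /(_ (inp x) [::] erefl) : forall u v, v ++ u = inp x ->
    let ys := map (@one_of _ P) u in
    foldr (fun iy (z : P) => Defs.pcomp z iy.1 iy.2) x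
      (zip (iota (size v) (size ys)) ys) = x by [].
elim=> [|c u IHu] v //= vu.
rewrite -(size_rcons v c) IHu ?cat_rcons // pcomp_one //.
by rewrite -vu onth_size_cat.
Qed.

Lemma one_of_inj : injective (@one_of _ P).
Proof. by move=> a b /(congr1 (@out _ P)); rewrite !out_one. Qed.

End Composition.

(** * Monomials of words *)

Section WordMonomials.
Variable C : finType.
Implicit Types (u v : seq C) (m n : {cmonom C}).

Lemma cmonE (D V : finType) (f : D -> V) (alpha : {ffun D -> nat}) (v : V) :
  cmon f alpha v = (\sum_(c | f c == v) alpha c)%N.
Proof.
have expE (i : V) (k : nat) : expcmn (ucm i) k v = ((i == v) * k)%N.
  rewrite /expcmn; elim: k => [|[|k] IHk]; first by rewrite muln0 cm1.
    by rewrite /= cmU muln1.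
  rewrite -[LHS]/(mmul (ucm i) (iterop k.+1 (@mulcm V) (ucm i) (@onecm V)) v).
  by rewrite cmM IHk cmU [RHS]mulnS.
rewrite [RHS]big_mkcond /cmon.
elim/big_rec2: _ => [|c k m _ IH]; first by rewrite cm1.
by rewrite cmM expE -IH; case: eqP; rewrite ?mul1n ?mul0n.
Qed.

(** The commutative image of a word, that is Y to the power of its type. *)
Definition wmon u : {cmonom C} := cmon id (ctype u).

Lemma cmon_idE (alpha : {ffun C -> nat}) c : cmon id alpha c = alpha c.
Proof. by rewrite cmonE big_pred1_eq. Qed.

Lemma wmonE u c : wmon u c = count_mem c u.
Proof. by rewrite cmon_idE ffunE. Qed.

Lemma wmon_cat u v : wmon (u ++ v) = mmul (wmon u) (wmon v).
Proof. by apply/eqP/cmP => c; rewrite cmM !wmonE count_cat. Qed.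

Lemma wmon1 c : wmon [:: c] = ucm c.
Proof. by apply/eqP/cmP => d; rewrite wmonE cmU /= addn0. Qed.

Lemma wmon0 : wmon [::] = mone.
Proof. by apply/eqP/cmP => d; rewrite wmonE cm1. Qed.

(** A word with commutative image [m]. *)
Definition mword m : seq C := type_word [ffun c => m c].

Lemma count_type_word (alpha : {ffun C -> nat}) c :
  count_mem c (type_word alpha) = alpha c.
Proof.
rewrite /type_word count_flatten -map_comp sumnE big_map big_enum /=.
rewrite (bigD1 c) //= count_nseq /= eqxx mul1n big1 ?addn0 // => d /negPf dc.
by rewrite count_nseq /= dc.
Qed.

Lemma mwordK : cancel mword wmon.
Proof. by move=> m; apply/eqP/cmP => c; rewrite wmonE count_type_word ffunE. Qed.

(** The weight of a monomial, additively extending a weight of the colors. *)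
Definition mweight (w : C -> nat) m : nat := (\sum_c m c * w c)%N.

Lemma mweight_wmon w u : mweight w (wmon u) = (\sum_(c <- u) w c)%N.
Proof.
rewrite /mweight; elim: u => [|d u IHu].
  by rewrite big_nil big1 // => c _; rewrite wmonE.
rewrite big_cons -IHu (eq_bigr (fun c => (d == c) * w c + wmon u c * w c)%N).
  rewrite big_split /= (bigD1 d) //= eqxx mul1n big1 ?addn0 // => c.
  by rewrite eq_sym => /negPf->.
by move=> c _; rewrite !wmonE /= mulnDl.
Qed.

Lemma mweight1_wmon u : mweight (fun=> 1%N) (wmon u) = size u.
Proof. by rewrite mweight_wmon big_const_seq count_predT iter_addn_0 mul1n. Qed.

Lemma mweight1E m : mweight (fun=> 1%N) m = size (mword m).
Proof. by rewrite -mweight1_wmon mwordK. Qed.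

Lemma leq_mweight w m c : (0 < w c)%N -> (m c <= mweight w m)%N.
Proof.
move=> wc; rewrite /mweight (bigD1 c) //=; apply: leq_trans (leq_addr _ _).
exact: leq_pmulr.
Qed.

End WordMonomials.

(** * Words of rules and the polynomials they generate *)

Section RuleWords.
Variables (K : fieldType) (C : finType) (P : colored_operad C).
Variables (R : set P) (finR : finite_set R).

(** The sequences of elements of [R] which can be grafted on an element whose
    word of input colors is [u]. *)
Fixpoint rule_words (u : seq C) : seq (seq P) :=
  if u is c :: u' then
    [seq r :: rs | r <- [seq r <- fset_set R | out r == c], rs <- rule_words u']
  else [:: [::]].

Lemma mem_fset_set r : (r \in fset_set R) = `[< R r >].
Proof. by rewrite in_fset_set //; apply/idP/asboolP; rewrite in_setE. Qed.

Lemma mem_rule_words u rs : (rs \in rule_words u) =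
  (map (@out _ P) rs == u) && all (mem (fset_set R)) rs.
Proof.
elim: u rs => [|c u IHu] rs /=; first by case: rs.
apply/allpairsP/idP => [[[r rs'] /= []]|].
  rewrite mem_filter IHu => /andP[/eqP <- rR] /andP[/eqP <- rsR] -> /=.
  by rewrite eqxx rR.
case: rs => [|r rs] //= /andP[/eqP[oc ou] /andP[rR rsR]].
by exists (r, rs); rewrite mem_filter IHu oc ou !eqxx rR rsR.
Qed.

Lemma rule_words_uniq u : uniq (rule_words u).
Proof.
elim: u => [|c u IHu] //=; apply: allpairs_uniq => //.
  exact/filter_uniq/fset_uniq.
by move=> [r rs] [r' rs'] _ _ /= [-> ->].
Qed.

Lemma size_rule_words u rs : rs \in rule_words u -> size rs = size u.
Proof. by rewrite mem_rule_words => /andP[/eqP <- _]; rewrite size_map. Qed.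

(** The polynomial of the rules with output color [a]. *)
Definition color_poly (a : C) : {malg K[{cmonom C}]} :=
  \sum_(r \in [set r | R r /\ out r = a])
     (<< wmon (inp r) >> : {malg K[{cmonom C}]}).

(** The input colors of an element in which the sequence [rs] is grafted. *)
Definition word_inp (rs : seq P) : seq C := flatten (map (@inp _ P) rs).

Lemma color_polyE a : color_poly a =
  \sum_(r <- fset_set R | out r == a) (<< wmon (inp r) >> : {malg K[_]}).
Proof.
rewrite /color_poly (@fsbig_seq_cond _ _ _ (fset_set R)) ?fset_uniq //.
  rewrite big_seq_cond [RHS]big_seq_cond; apply: eq_bigl => r.
  rewrite mem_fset_set; case: asboolP => //= Rr.
  by apply/idP/eqP => [/set_mem[]|ra]; last exact/mem_set.
by move=> r [Rr _]; rewrite mem_fset_set; case: asboolP.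
Qed.

(** Expanding the product amounts to choosing a rule for each letter. *)
Lemma prod_color_polyE u : \prod_(c <- u) color_poly c =
  \sum_(rs <- rule_words u) (<< wmon (word_inp rs) >> : {malg K[_]}).
Proof.
elim: u => [|c u IHu] /=.
  by rewrite big_nil big_seq1 /word_inp /= wmon0.
rewrite big_cons IHu color_polyE [RHS]big_allpairs_dep big_filter big_distrl /=.
apply: eq_bigr => r _; rewrite big_distrr /=; apply: eq_bigr => rs _.
by rewrite /word_inp /= wmon_cat malgM_def fgmulUU mul1r.
Qed.

Lemma coef_prod_color_poly u m : (\prod_(c <- u) color_poly c)@_m =
  \sum_(rs <- rule_words u) (wmon (word_inp rs) == m)%:R.
Proof.
by rewrite prod_color_polyE raddf_sum /=; apply: eq_bigr => rs _; rewrite mcoeffU1.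
Qed.

Lemma coef_prod_color_poly_neq0 u m : (\prod_(c <- u) color_poly c)@_m != 0 ->
  exists2 rs, rs \in rule_words u & wmon (word_inp rs) = m.
Proof.
rewrite coef_prod_color_poly => nz; apply: contrapT => no_rs; case/eqP: nz.
rewrite big1_seq // => rs /= rsu; case: eqP => // rsm; case: no_rs.
by exists rs.
Qed.

Lemma prod_expr_count (A : comNzRingType) (p : C -> A) u :
  \prod_c p c ^+ count_mem c u = \prod_(c <- u) p c.
Proof.
elim: u => [|d u IHu]; first by rewrite big_nil big1.
rewrite big_cons -IHu (eq_bigr (fun c => p c ^+ (d == c) * p c ^+ count_mem c u)).
  rewrite big_split /= (bigD1 d) //= eqxx big1 ?mulr1 // => c.
  by rewrite eq_sym => /negPf->.
by move=> c _; rewrite -exprD.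
Qed.

(** The monomial [n] of [f] is represented by the word [mword n], so that
    substituting in it is a product over a word. *)
Lemma psubstE (f : pseries K C) m : psubst f color_poly m =
  \sum_(n \in [set: {cmonom C}])
     f n * (\prod_(c <- mword n) color_poly c)@_m.
Proof.
apply: eq_fsbigr => n _; rewrite -(prod_expr_count _ (mword n)); congr (_ * _@_m).
by apply: eq_bigr => c _; rewrite -wmonE mwordK.
Qed.

(** [w] is a positive weight, and the total weight of the inputs of each element
    of [R] exceeds the weight of its output. *)
Definition expanding (w : C -> nat) : Prop :=
  (forall c, (0 < w c)%N) /\
  (forall r, R r -> (w (out r) < \sum_(c <- inp r) w c)%N).

Lemma expanding_rule_words w u rs : expanding w -> rs \in rule_words u ->
  (\sum_(c <- u) w c + size u <= \sum_(c <- word_inp rs) w c)%N.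
Proof.
move=> [_ wR]; rewrite mem_rule_words => /andP[/eqP <-].
elim: rs => [|r rs IHrs] /=; first by rewrite big_nil.
rewrite mem_fset_set => /andP[/asboolP/wR wr /IHrs].
rewrite /word_inp /= big_cons big_cat /= => le_rs.
by rewrite addnS -!addSn -addnA leq_add.
Qed.

Section Triangular.
Variables (w : C -> nat) (exp_w : expanding w).

(** Substitution is strictly triangular for the weight, except on the constant
    term. *)
Lemma coef_color_poly_weight n m :
  (\prod_(c <- mword n) color_poly c)@_m != 0 ->
  (mweight w n + size (mword n) <= mweight w m)%N.
Proof.
move=> /coef_prod_color_poly_neq0[rs rsn <-].
by rewrite -{1}[n]mwordK !mweight_wmon expanding_rule_words.
Qed.

(** Finitely many monomials, among which all those of weight at most [N]. *)
Definition light_monomials N : seq {cmonom C} :=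
  undup [seq cmon id [ffun c => g c : nat] | g : {ffun C -> 'I_N.+1}].

Lemma mem_light_monomials N m : (mweight w m <= N)%N -> m \in light_monomials N.
Proof.
move=> mN; rewrite mem_undup; apply/mapP.
exists [ffun c => inord (m c)]; first by rewrite mem_enum.
apply/eqP/cmP => c; rewrite cmon_idE !ffunE inordK // ltnS.
by apply: leq_trans mN; apply: leq_mweight; case: exp_w.
Qed.

Lemma psubst_light (f : pseries K C) m N : (mweight w m <= N)%N ->
  psubst f color_poly m = \sum_(n <- light_monomials N)
     f n * (\prod_(c <- mword n) color_poly c)@_m.
Proof.
move=> mN; rewrite psubstE (@fsbig_seq_cond _ _ _ (light_monomials N)).
- by apply: eq_bigl => n; rewrite in_setT.
- exact: undup_uniq.
move=> n _ nN; suff /eqP-> : (\prod_(c <- mword n) color_poly c)@_m == 0.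
  by rewrite mulr0.
apply: contraNT nN => /coef_color_poly_weight le_nm.
exact/mem_light_monomials/(leq_trans _ mN)/(leq_trans _ le_nm)/leq_addr.
Qed.

Local Notation S := (fun f : pseries K C => psubst f color_poly).

Lemma psubstD (f g : pseries K C) m :
  psubst (f \+ g) color_poly m = psubst f color_poly m + psubst g color_poly m.
Proof.
rewrite !(psubst_light _ (leqnn _)) -big_split /=.
by apply: eq_bigr => n _; rewrite mulrDl.
Qed.

Lemma iter_psubstD N (f g : pseries K C) :
  iter N S (f \+ g) = iter N S f \+ iter N S g.
Proof.
elim: N => //= N ->; apply/funext => m; exact: psubstD.
Qed.

Lemma iter_psubst0 N (f : pseries K C) m : m != mone ->
  (mweight w m < N)%N -> iter N S f m = 0.
Proof.
elim: N m => // N IHN m m1; rewrite ltnS => mN.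
rewrite iterS (psubst_light _ (leqnn _)) big1 // => n _.
have [->|] := eqVneq (\prod_(c <- mword n) color_poly c)@_m 0; first by rewrite mulr0.
move=> nz; have := coef_color_poly_weight nz.
have [n1|n1 le_nm] := eqVneq n mone.
  (* The constant monomial only contributes to the constant term. *)
  move: nz; rewrite {}n1 -(wmon0 C) -prod_expr_count.
  rewrite big1 => [|c _]; first by rewrite mcoeff1 (negPf m1) eqxx.
  by rewrite -wmonE mwordK wmonE.
rewrite IHN ?mul0r //; apply: leq_trans mN; apply: leq_trans le_nm.
rewrite -addn1 leq_add2l lt0n size_eq0; apply: contraNneq n1 => n0.
by rewrite -[n]mwordK n0 wmon0.
Qed.

(** A solution of f = h + f o p is the sum of the iterates of h under
    substitution, up to its constant term. *)
Lemma fixpoint_psubst (f h : pseries K C) m N : f = h \+ psubst f color_poly ->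
  m != mone -> (mweight w m < N)%N -> f m = \sum_(l < N) iter l S h m.
Proof.
move=> fE m1 mN; suff -> : f m = \sum_(l < N) iter l S h m + iter N S f m.
  by rewrite iter_psubst0 ?addr0.
elim: N {mN} => [|N IHN]; first by rewrite big_ord0 add0r.
rewrite big_ord_recr /= -addrA {}IHN; congr (_ + _).
by rewrite {1}fE iter_psubstD -[in RHS]/(iter N.+1 S f m) iterSr.
Qed.

End Triangular.
End RuleWords.

(** * Series of color types *)

Section ColorTypes.
Variables (K : fieldType) (C : finType) (P : colored_operad C).
Hypothesis lfP : locally_finite P.
Variables (R : set P) (finR : finite_set R).
Implicit Types (g h : oseries K P) (x y : P) (m n : {cmonom C}).

(** The elements of arity at most [N]; there are finitely many of them. *)
Definition small_elements N : seq P := fset_set [set x : P | (arity x <= N)%N].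

Lemma mem_small_elements N x : (x \in small_elements N) = (arity x <= N)%N.
Proof.
rewrite in_fset_set; first by apply/idP/idP => [/set_mem|xN] //; exact/mem_set.
rewrite (_ : [set x : P | _] = \bigcup_(k in `I_N.+1) [set x : P | arity x = k]).
  by apply: bigcup_finite => [|k _]; [exact: finite_II | exact: lfP].
apply/seteqP; split=> [z zN|z [k /= kN zk]]; first by exists (arity z).
by rewrite /= zk.
Qed.

(** The series in the variables Y which is the coefficient of x_a in the series
    of color types. *)
Definition out_colt (a : C) g : pseries K C := fun m =>
  \sum_(x \in [set x : P | out x = a /\ wmon (inp x) = m]) g x.

Lemma coltE a g (alpha : {ffun C -> nat}) :
  colt g (mmul (ucm (inl a)) (cmon inr alpha)) = out_colt a g (cmon id alpha).
Proof.
apply: eq_fsbigl; apply/seteqP.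
have cm_inl (b c : C) (beta : {ffun C -> nat}) :
    mmul (ucm (inl b)) (cmon inr beta) (inl c) = (b == c) :> nat.
  by rewrite cmM cmU cmonE big_pred0 ?addn0.
have cm_inr (b c : C) (beta : {ffun C -> nat}) :
    mmul (ucm (inl b)) (cmon inr beta) (inr c) = beta c.
  by rewrite cmM cmU cmonE (big_pred1 c).
split=> x /=; last first.
  move=> [<- xa]; congr (mmul _ (cmon _ _)); apply/ffunP => c.
  by rewrite -cmon_idE -/(wmon _) xa cmon_idE.
move=> E; split.
  have := congr1 (fun m : {cmonom _} => m (inl a)) E.
  by rewrite !cm_inl eqxx; case: eqP.
apply/eqP/cmP => c; have := congr1 (fun m : {cmonom _} => m (inr c)) E.
by rewrite !cm_inr cmon_idE cmon_idE.
Qed.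

Lemma out_coltE a g m N : (mweight (fun=> 1%N) m <= N)%N ->
  out_colt a g m =
  \sum_(x <- small_elements N | (out x == a) && (wmon (inp x) == m)) g x.
Proof.
move=> mN; rewrite /out_colt (@fsbig_seq_cond _ _ _ (small_elements N)).
- apply: eq_bigl => x.
  by apply/idP/andP => [/set_mem[/eqP + /eqP]|[/eqP ? /eqP ?]] //; exact/mem_set.
- exact: fset_uniq.
move=> x [_ xm]; rewrite mem_small_elements /arity -mweight1_wmon xm.
by rewrite mN.
Qed.

Lemma eq_out_colt a g h m : (forall x, out x = a -> wmon (inp x) = m -> g x = h x) ->
  out_colt a g m = out_colt a h m.
Proof. by move=> gh; apply: eq_fsbigr => x /set_mem[]; exact: gh. Qed.

Lemma out_colt_sum a (I : Type) (s : seq I) (F : I -> oseries K P) m :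
  out_colt a (fun x => \sum_(i <- s) F i x) m = \sum_(i <- s) out_colt a (F i) m.
Proof.
rewrite (out_coltE _ _ (leqnn _)) exchange_big; apply: eq_bigr => i _.
by rewrite (out_coltE _ _ (leqnn _)).
Qed.

Lemma out_colt_ones a : out_colt a (char_series K (ones setT)) = pvar K a.
Proof.
apply/funext => m; rewrite /out_colt (@fsbig_seq_cond _ _ _ [:: one_of P a]) //.
  rewrite big_mkcond big_seq1 /pvar /char_series.
  have -> : one_of P a \in ones setT = true by apply/mem_set; exists a.
  rewrite (_ : (_ \in _) = (m == ucm a)); first by case: eqP.
  apply/idP/eqP => [/set_mem[_ <-]|->]; first by rewrite inp_one wmon1.
  by apply/mem_set; rewrite /= out_one inp_one wmon1.
move=> x [xa _]; rewrite inE /char_series => xn1.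
case: (boolP (x \in _)) => // /set_mem[b _ bx].
by move: xn1; rewrite -xa -bx out_one eqxx.
Qed.

Lemma size_word_inp (zs : seq P) : (size zs <= size (word_inp zs))%N.
Proof.
elim: zs => //= z zs IHzs; rewrite /word_inp /= size_cat -add1n leq_add //.
exact: inp_gt0.
Qed.

Lemma prod_char_series (A : set P) (zs : seq P) :
  \prod_(z <- zs) char_series K A z = (all (mem A) zs)%:R.
Proof.
elim: zs => [|z zs IHzs]; first by rewrite big_nil.
by rewrite big_cons IHzs /char_series /= -natrM mulnb.
Qed.

(** The coefficient at [x] only involves the [y] of arity at most that of [x],
    since every rule has at least one input. *)
Lemma oprod_rulesE g x N : (arity x <= N)%N ->
  oprod g (char_series K R) x =
  \sum_(y <- small_elements N) \sum_(zs <- rule_words R (inp y))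
    g y *+ (x == ccomp y zs).
Proof.
move=> xN; rewrite /oprod.
pose s := [seq (y, zs) | y <- small_elements N, zs <- rule_words R (inp y)].
rewrite (@fsbig_seq_cond _ _ _ s).
- rewrite big_mkcond /s big_allpairs_dep; apply: eq_bigr => y _.
  apply: eq_big_seq => zs; rewrite mem_rule_words // => /andP[/eqP yzs zsR] /=.
  rewrite prod_char_series (_ : all _ zs) ?mulr1; last first.
    apply/allP => z zzs; apply/mem_set; move/allP: zsR => /(_ _ zzs) /=.
    by rewrite mem_fset_set // => /asboolP.
  case: (eqVneq x (ccomp y zs)) => [->|ne]; first by rewrite mem_set.
  by rewrite memNset //= => -[_] /eqP; rewrite (negPf ne).
- apply: allpairs_uniq_dep => [|y _|[y zs] [y' zs'] _ _ /= [-> ->]] //.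
    exact: fset_uniq.
  exact: rule_words_uniq.
move=> [y zs] /= [yzs xE]; rewrite prod_char_series => ys.
have [zsR|] := boolP (all _ zs); last by rewrite mulr0.
case/negP: ys; apply/allpairsPdep; exists y, zs.
have zsu : zs \in rule_words R (inp y).
  rewrite mem_rule_words // yzs eqxx; apply/allP => z /(allP zsR)/set_mem Rz /=.
  by rewrite mem_fset_set //; apply/asboolP.
split=> //; rewrite mem_small_elements; apply: leq_trans xN.
by rewrite xE /arity inp_ccomp // -yzs size_map; exact: size_word_inp.
Qed.

(** Composing with rules in a series amounts to substituting their polynomials
    in its series of color types. *)
Lemma out_colt_oprod a g :
  out_colt a (oprod g (char_series K R)) = psubst (out_colt a g) (color_poly K R).
Proof.
apply/funext => m; set N := mweight (fun=> 1%N) m.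
pose coef u := (\prod_(c <- u) color_poly K R c)@_m.
have coef_small u : coef u != 0 -> (size u <= N)%N.
  move=> /(coef_prod_color_poly_neq0 finR)[zs zsu zsm].
  rewrite -(size_rule_words zsu) /N -zsm mweight1_wmon.
  exact: size_word_inp.
(* Both sides are sums over y, on the left after exchanging it with the sum over
   the composites x, on the right after grouping the y by type. *)
transitivity (\sum_(y <- small_elements N | out y == a) g y * coef (inp y)).
  rewrite (@out_coltE _ _ _ N) // big_seq_cond.
  under eq_bigr => x /andP[+ _] do
    rewrite mem_small_elements => /(oprod_rulesE g) ->.
  rewrite -big_seq_cond exchange_big [RHS]big_mkcond; apply: eq_bigr => y _ /=.
  rewrite exchange_big /= /coef coef_prod_color_poly //.
  transitivity (\sum_(zs <- rule_words R (inp y))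
      g y *+ ((out y == a) && (wmon (word_inp zs) == m))).
    apply: eq_big_seq => zs; rewrite mem_rule_words // => /andP[/eqP yzs _].
    rewrite (sum_seq_pred1 (g y) (fset_uniq _)) out_ccomp // inp_ccomp //.
    move=> /andP[_ /eqP wm]; rewrite mem_small_elements /arity inp_ccomp //.
    by rewrite -mweight1_wmon wm.
  case: ifP => _; last by rewrite big1.
  by rewrite big_distrr; apply: eq_bigr => zs _ /=; rewrite mulr_natr.
rewrite psubstE //.
pose s := undup [seq wmon (inp y) | y <- small_elements N].
rewrite (@fsbig_seq_cond _ _ _ s) ?undup_uniq //; last first.
  move=> n _ ns; rewrite -/(coef _).
  have [->|/coef_small nN] := eqVneq (coef (mword n)) 0; first by rewrite mulr0.
  rewrite [out_colt _ _ _](_ : _ = 0) ?mul0r //.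
  rewrite /out_colt fsbig1 // => y [_ yn]; case/negP: ns.
  rewrite mem_undup -yn (map_f (fun z : P => wmon (inp z))) // mem_small_elements.
  by rewrite /arity -mweight1_wmon yn mweight1E.
transitivity (\sum_(n <- s) \sum_(y <- small_elements N | out y == a)
    (g y * coef (inp y)) *+ (n == wmon (inp y))).
  rewrite exchange_big big_seq_cond [RHS]big_seq_cond /=.
  apply: eq_bigr => y /andP[yN _].
  rewrite (@sum_seq_pred1 _ _ s _ xpredT) ?undup_uniq // => _.
  by rewrite mem_undup (map_f (fun z : P => wmon (inp z))).
rewrite [RHS](eq_bigl xpredT) => [|n]; last by rewrite in_setT.
apply: eq_big_seq => n; rewrite mem_undup => /mapP[x].
rewrite mem_small_elements => xN nx.
rewrite (@out_coltE _ _ _ N) ?nx ?mweight1_wmon // big_distrl [RHS]big_mkcondr /=.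
apply: eq_bigr => y _; rewrite -nx eq_sym; case: eqP => [yn|_]; last by rewrite mulr0n.
rewrite mulr1n /coef -(prod_expr_count _ (mword n)) -(prod_expr_count _ (inp y)).
congr (_ * _@_m).
by apply: eq_bigr => c _; rewrite -!wmonE mwordK yn.
Qed.

Lemma out_colt_oexp a l : out_colt a (oexp (char_series K R) l) =
  iter l (fun f => psubst f (color_poly K R)) (pvar K a).
Proof.
elim: l => [|l IHl] /=; first exact: out_colt_ones.
by rewrite out_colt_oprod IHl.
Qed.

(** Each synchronous step makes the weight grow, so that the number of steps
    leading to [x] is at most the weight of its inputs. *)
Lemma oexp_weight w l x : expanding R w ->
  (mweight w (wmon (inp x)) < l)%N -> oexp (char_series K R) l x = 0.
Proof.
move=> wR; elim: l x => // l IHl x; rewrite ltnS => xl /=.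
rewrite (oprod_rulesE _ (leqnn _)) big1 // => y _.
rewrite big1_seq // => zs /= zsy; case: eqP => [xE|]; last by rewrite mulr0n.
rewrite IHl ?mul0rn //; apply: leq_trans xl.
have yzs : ccomposable y zs.
  by move: zsy; rewrite mem_rule_words // => /andP[/eqP].
have := expanding_rule_words finR wR zsy.
rewrite xE inp_ccomp // !mweight_wmon; apply: leq_trans.
by rewrite -addn1 leq_add2l; exact: inp_gt0.
Qed.

Lemma ostarE w x N : expanding R w -> (mweight w (wmon (inp x)) < N)%N ->
  ostar (char_series K R) x = \sum_(l < N) oexp (char_series K R) l x.
Proof.
move=> wR xN; rewrite /ostar (@fsbig_seq_cond _ _ _ (iota 0 N)) ?iota_uniq //.
  rewrite -[in RHS](big_mkord xpredT (fun l => oexp _ l x)) /index_iota subn0.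
  by apply: eq_bigl => l; rewrite in_setT.
move=> l _; rewrite mem_iota /= add0n -leqNgt => Nl.
by apply: oexp_weight wR _; exact: leq_trans Nl.
Qed.

(** Multiplying on the left by units selects the output color. *)
Lemma oprod_ones_l (I : set C) g x :
  oprod (char_series K (ones I)) g x = g x *+ `[< I (out x) >].
Proof.
have one_x : ccomposable (one_of P (out x)) [:: x] by rewrite /ccomposable inp_one.
have one_xE : ccomp (one_of P (out x)) [:: x] = x by rewrite /ccomp /= one_pcomp.
rewrite /oprod (@fsbig_seq_cond _ _ _ [:: (one_of P (out x), [:: x])]) //.
  rewrite big_mkcond big_seq1 mem_set /= ?big_seq1 ?one_xE // /char_series.
  rewrite (_ : _ \in _ = `[< I (out x) >]) ?mulr_natl //.
  apply/idP/asboolP => [/set_mem[b Ib /one_of_inj <-]|Ix] //.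
  by apply/mem_set; exists (out x).
move=> [y zs] /= [yzs xE]; rewrite inE /char_series => ne.
case: (boolP (y \in _)) => [/set_mem[b _ bE]|]; last by rewrite mul0r.
subst y; move: yzs xE ne; rewrite /ccomposable inp_one.
case: zs => [|z [|z' zs]] //= -[zb]; rewrite /ccomp /= -zb one_pcomp => ->.
by rewrite eqxx.
Qed.

(** Multiplying on the right by units selects the input colors. *)
Lemma oprod_ones_r (T : set C) g x :
  oprod g (char_series K (ones T)) x = g x *+ all (fun c => `[< T c >]) (inp x).
Proof.
have comp_x : ccomposable x (map (one_of P) (inp x)) by exact: map_out_one.
rewrite /oprod (@fsbig_seq_cond _ _ _ [:: (x, map (one_of P) (inp x))]) //.
  rewrite big_mkcond big_seq1 mem_set /= ?ccomp_ones // prod_char_series all_map.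
  rewrite mulr_natr; congr (_ *+ nat_of_bool _); apply: eq_all => c /=.
  apply/idP/asboolP => [/set_mem[b Tb /one_of_inj <-]|Tc] //.
  by apply/mem_set; exists c.
move=> [y zs] /= [yzs xE]; rewrite inE prod_char_series => ne.
have [zs1|] := boolP (all _ zs); last by rewrite mulr0.
case/negP: ne; suff zsE : zs = map (one_of P) (inp y).
  by rewrite xE zsE ccomp_ones.
rewrite -yzs -map_comp -[LHS]map_id; apply/eq_in_map => z /(allP zs1)/set_mem[b _ <-].
by rewrite /= out_one.
Qed.

End ColorTypes.

(** * Acyclicity of the unary elements *)

Section Acyclicity.
Variables (C : finType) (P : colored_operad C) (S : set P).

(** [rs] is a chain of unary elements of [S], each of them being composable with
    the next one, from the output color [a] to the input color [b]. *)
Fixpoint unary_chain (a : C) (rs : seq P) (b : C) : Prop :=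
  if rs is r :: rs' then
    exists c, [/\ S r, out r = a, inp r = [:: c] & unary_chain c rs' b]
  else a = b.

(** The tree with a single leaf, of color [b], and whose nodes are labeled by
    [rs] from the root on. *)
Definition chain_tree (rs : seq P) (b : C) : tree P :=
  foldr (fun r t => Node r [:: t]) (Leaf P b) rs.

Lemma unary_chain_cat a b c rs rs' :
  unary_chain a rs b -> unary_chain b rs' c -> unary_chain a (rs ++ rs') c.
Proof.
elim: rs a => [|r rs IHrs] a /= => [->|] // [d [Sr ra rd drs] brs].
by exists d; split=> //; exact: IHrs.
Qed.

Lemma chain_tree_inj b : injective (chain_tree^~ b).
Proof.
elim=> [|r rs IHrs] [|r' rs'] //= E.
have /IHrs-> : chain_tree rs b = chain_tree rs' b by case: E.
by case: E => ->.
Qed.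

Lemma chain_treeP a rs b : unary_chain a rs b ->
  let t := chain_tree rs b in
  [/\ in_Free S t, tree_out t = a, out (ev t) = a & arity (ev t) = 1%N].
Proof.
elim: rs a => [|r rs IHrs] a /= => [->|].
  by split=> //; rewrite ?out_one // /arity inp_one.
move=> [c [Sr ra rc /IHrs[tF ot oe ae]]].
have rt : onth (inp r) 0 = Some (out (ev (chain_tree rs b))) by rewrite rc oe.
split=> //; first by rewrite /= ot rc.
  by rewrite /ccomp /= out_pcomp.
rewrite /arity /ccomp /= inp_pcomp // rc /splice /= cats0.
exact: ae.
Qed.

Hypotheses (fin1 : finite_set [set x : P | arity x = 1%N])
  (ffS : finitely_factorizes S).

(** A cycle of unary elements of [S] would yield infinitely many trees, of
    which the evaluations are among the finitely many elements of arity 1. *)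
Lemma no_unary_cycle a r rs : ~ unary_chain a (r :: rs) a.
Proof.
move=> cyc; pose t n := chain_tree (flatten (nseq n (r :: rs))) a.
have cyc_n n : unary_chain a (flatten (nseq n (r :: rs))) a.
  elim: n => [|n IHn]; first by [].
  exact: (unary_chain_cat cyc IHn).
pose B := \bigcup_(x in [set x : P | arity x = 1%N]) [set t | in_Free S t /\ ev t = x].
have finB : finite_set B by apply: bigcup_finite => // x _; exact: ffS.
apply: infinite_nat; rewrite (_ : setT = t @^-1` B).
  apply: finite_preimage finB => m n _ _ /chain_tree_inj/(congr1 size).
  by rewrite !size_flatten /shape !map_nseq !sumn_nseq => /eqP;
    rewrite eqn_mul2l => /eqP.
apply/seteqP; split=> // n _.
by have [tF _ _ t1] := chain_treeP (cyc_n n); exists (ev (t n)).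
Qed.

(** [a] and [b] are the output and the input colors of a unary element of [S]. *)
Definition unary_edge : rel C :=
  fun a b => `[< exists r, [/\ S r, out r = a & inp r = [:: b]] >].

Lemma connect_unary_chain a b : connect unary_edge a b ->
  exists rs, unary_chain a rs b.
Proof.
case/connectP => p; elim: p a => [|c p IHp] a /=; first by move=> _ ->; exists [::].
move=> /andP[/asboolP[r [Sr ra rc]] /IHp h /h[rs crs]].
by exists (r :: rs); exists c.
Qed.

(** The number of ancestors is a rank which increases along unary elements; it is
    shifted by [#|C|] so that it also grows along elements of arity at least 2. *)
Definition ancestor_weight (b : C) : nat :=
  (#|C| + #|[set a | connect unary_edge a b]%SET|)%N.

Lemma ancestor_weight_expanding (R : set P) :
  (forall r, R r -> arity r = 1%N -> S r) -> expanding R ancestor_weight.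
Proof.
move=> RS; have anc_gt0 c : (0 < #|[set a | connect unary_edge a c]%SET|)%N.
  by apply/card_gt0P; exists c; rewrite inE connect0.
split=> [c|r Rr]; first by rewrite addn_gt0 anc_gt0 orbT.
case ri: (inp r) (RS r Rr) (inp_gt0 r) => [|b [|c u]] //; rewrite /arity ri /=.
  move=> /(_ erefl) Sr _; rewrite big_seq1 ltn_add2l; apply: proper_card.
  have rb : unary_edge (out r) b by apply/asboolP; exists r.
  apply/properP; split.
    apply/fintype.subsetP => a; rewrite !inE => /connect_trans; apply.
    exact: connect1.
  exists b; rewrite inE ?connect0 //; apply/negP => /connect_unary_chain[rs brs].
  by apply: (@no_unary_cycle (out r) r rs); exists b.
move=> _ _; rewrite !big_cons addnA; apply: leq_trans (leq_addr _ _).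
rewrite -addnS; apply: leq_add; first exact: leq_addr.
by rewrite -addn1; apply: leq_add (anc_gt0 c); exact: max_card.
Qed.

End Acyclicity.

(** * Synchronous derivations *)

Section Synchronous.
Variables (K : fieldType) (B : bud_system).
Hypothesis lfO : locally_finite (ground B).
Local Notation C := (colors B).
Local Notation BudB := (Bud (colors B) (ground B)).

Lemma Bud_locally_finite : locally_finite BudB.
Proof.
move=> n; pose proj (x : BudB) := val x.
pose words := [set u : seq C | size u = n].
have fin_words : finite_set words.
  apply: (@sub_finite_set _ _ [set` [seq val t | t : n.-tuple C]]).
    move=> u un; apply/mapP; have un' : size u == n by apply/eqP.
    by exists (Tuple un'); rewrite ?mem_enum.
  exact: finite_seq.
(* A triple (a, x, u) of arity n is determined by the color a, the element x of
   O(n), and the word u of length n. *)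
pose A : set (C * ground B * seq C) := ([set: C] `*` [set x | arity x = n]) `*` words.
apply: (@sub_finite_set _ _ (proj @^-1` A)).
  move=> x xn; split=> /=; last exact: xn.
  by split=> //=; rewrite -xn; exact/esym/size_bud_inp.
apply: finite_preimage => [x y _ _|]; first exact: val_inj.
apply: finite_setX => //; apply: finite_setX; [exact: finite_finset | exact: lfO].
Qed.

Lemma syncE (x : BudB) : sync K B x = ostar (char_series K (rules B)) x
  *+ (`[< initial B (out x) >] && all (fun c => `[< terminal B c >]) (inp x)).
Proof. by rewrite /sync oprod_ones_r oprod_ones_l -mulrnA mulnb. Qed.

End Synchronous.

Theorem proposition3p4p7 (K : fieldType) (charK : [pchar K] =i pred0)
  (B : bud_system)
  (unambB : synchronously_unambiguous K B)
  (lfO : locally_finite (ground B))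
  (ffB : finitely_factorizes (unary_rules B))
  (f : colors B -> pseries K (colors B))
  (eq_f : forall a : colors B,
     f a = pvar K a \+ psubst (f a) (rule_poly K B))
  (a : colors B) (aI : initial B a)
  (alpha : {ffun colors B -> nat}) (alphaT : color_types alpha)
  (alphaP : nonempty_words (terminal B) (type_word alpha)) :
  colt (sync K B) (mmul (ucm (inl a)) (cmon inr alpha))
    = f a (cmon id alpha).
Proof.
have lfB := Bud_locally_finite lfO; have finR := rules_finite B.
have wR : expanding (rules B) (ancestor_weight (unary_rules B)).
  by apply: ancestor_weight_expanding; [exact: lfB | exact: ffB | move=> r].
set w := ancestor_weight _ in wR.
set m := cmon id alpha; pose N := (mweight w m).+1.
have [type_neq0 type_T] := alphaP.
have m1 : m != mone.
  apply: contraNneq type_neq0 => m_one; rewrite -size_eq0 -mweight1_wmon.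
  suff -> : wmon (type_word alpha) = wmon [::] by rewrite mweight1_wmon.
  by rewrite wmon0 -m_one; apply/eqP/cmP => c; rewrite wmonE count_type_word cmon_idE.
rewrite coltE -/m (fixpoint_psubst finR wR (eq_f a) m1 (ltnSn _)) -/N.
transitivity (out_colt a
    (fun x => \sum_(l < N) oexp (char_series K (rules B)) l x) m).
  apply: eq_out_colt => x xa xm; rewrite syncE xa asboolT //=.
  rewrite (ostarE K lfB finR wR (N := N)) ?xm // (_ : all _ _) //.
  apply/allP => c; rewrite -has_pred1 has_count -wmonE xm cmon_idE => c_gt0.
  apply/asboolP/type_T; rewrite -has_pred1 has_count count_type_word //.
rewrite out_colt_sum //; apply: eq_bigr => l _.
by rewrite out_colt_oexp.
Qed.
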